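(* Let $P_1$, $P_2$, $Q_1$ be MIAs with $p_1\in P_1$, $p_2\in P_2$, $q_1\in Q_1$ and $p_1\sqsubseteq_{\mathrm{MIA}} q_1$, and assume that $Q_1$ and $P_2$ are composable. Then (a) $P_1$ and $P_2$ are composable; and (b) if $q_1$ and $p_2$ are compatible, then $p_1$ and $p_2$ are compatible and $p_1|p_2\sqsubseteq_{\mathrm{MIA}} q_1|p_2$.
   Context: A dMTS is $(P,A,\longrightarrow_P,\dashrightarrow_P)$ with states $P$, alphabet $A$ not containing $\tau$, must-relation $\longrightarrow_P\subseteq P\times A\times(2^P\setminus\{\emptyset\})$, may-relation $\dashrightarrow_P\subseteq P\times(A\cup\{\tau\})\times P$, and syntactic consistency ($p\xrightarrow{a}P'$ implies $p\stackrel{a}{\dashrightarrow}p'$ for all $p'\in P'$). A Modal Interface Automaton (MIA) is $(P,I,O,\longrightarrow_P,\dashrightarrow_P)$ with $I,O$ disjoint such that $(P,I\cup O,\longrightarrow_P,\dashrightarrow_P)$ is a dMTS and for all $i\in I$: (a) $p\xrightarrow{i}P'$ and $p\xrightarrow{i}P''$ imply $P'=P''$; (b) $p\stackrel{i}{\dashrightarrow}p'$ implies $p\xrightarrow{i}P'$ for some $P'\ni p'$. Write $p\xrightarrow{a}$ ($p\stackrel{a}{\dashrightarrow}$) if some must- (may-) $a$-transition leaves $p$. Weak may: $p\stackrel{\epsilon}{\Longrightarrow}p'$ iff $p(\stackrel{\tau}{\dashrightarrow})^*p'$; $p\stackrel{\alpha}{\Longrightarrow}p'$ iff $\exists p''.\,p\stackrel{\epsilon}{\Longrightarrow}p''\stackrel{\alpha}{\dashrightarrow}p'$;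 $\hat\tau=\epsilon$, $\hat a=a$. For MIAs $P,Q$, $p\sqsubseteq_{\mathrm{MIA}}q$ means $P,Q$ have the same input and output alphabets and some $\mathcal R\subseteq P\times Q$ contains $(p,q)$ such that for all $(p,q)\in\mathcal R$: (i) $q\xrightarrow{a}Q'$ ($a\in I\cup O$) implies some $P'$ with $p\xrightarrow{a}P'$ and $\forall p'\in P'\,\exists q'\in Q'.\,(p',q')\in\mathcal R$; (ii) $p\stackrel{\alpha}{\dashrightarrow}p'$ with $\alpha\in O\cup\{\tau\}$ implies some $q'$ with $q\stackrel{\hat\alpha}{\Longrightarrow}q'$ and $(p',q')\in\mathcal R$. Parallel composition: MIAs $P_1,P_2$ with alphabets $A_j=I_j\cup O_j$ are composable if $A_1\cap A_2=(I_1\cap O_2)\cup(O_1\cap I_2)$. Their product $P_1\otimes P_2$ has states $P_1\times P_2$, inputs $I=(I_1\cup I_2)\setminus(O_1\cup O_2)$, outputs $O=(O_1\cup O_2)\setminus(I_1\cup I_2)$, and transitions: (Must1) $(p_1,p_2)\xrightarrow{a}P_1'\times\{p_2\}$ if $p_1\xrightarrow{a}P_1'$ and $a\notin A_2$; (Must2) $(p_1,p_2)\xrightarrow{a}\{p_1\}\times P_2'$ if $p_2\xrightarrow{a}P_2'$ and $a\notin A_1$; (May1) $(p_1,p_2)\stackrel{\alpha}{\dashrightarrow}(p_1',p_2)$ if $p_1\stackrel{\alpha}{\dashrightarrow}p_1'$ and $\alpha\notin A_2$; (May2) $(p_1,p_2)\stackrel{\alpha}{\dashrightarrow}(p_1,p_2')$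 if $p_2\stackrel{\alpha}{\dashrightarrow}p_2'$ and $\alpha\notin A_1$; (May3) $(p_1,p_2)\stackrel{\tau}{\dashrightarrow}(p_1',p_2')$ if $p_1\stackrel{a}{\dashrightarrow}p_1'$ and $p_2\stackrel{a}{\dashrightarrow}p_2'$ for some $a$. A state $(p_1,p_2)$ is an error state if for some $a\in A_1\cap A_2$ either $a\in O_1$, $p_1\stackrel{a}{\dashrightarrow}$ and $p_2$ has no $a$-must-transition, or $a\in O_2$, $p_2\stackrel{a}{\dashrightarrow}$ and $p_1$ has no $a$-must-transition. The set $E$ of incompatible states is the least set containing all error states and every $(p_1,p_2)$ with $(p_1,p_2)\stackrel{\alpha}{\dashrightarrow}(p_1',p_2')\in E$ for some $\alpha\in O\cup\{\tau\}$. $P_1|P_2$ is obtained from $P_1\otimes P_2$ by removing all states in $E$ and every transition having such a state as its source, target, or one of its targets, and also deleting all may-transitions underlying a removed must-transition. If $(p_1,p_2)$ is a state of $P_1|P_2$ (i.e., not in $E$), $p_1$ and $p_2$ are called compatible and the state is written $p_1|p_2$. *)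

(* Defs.v *)
From mathcomp Require Import all_boot.
From mathcomp Require Import boolp classical_sets.
From Stdlib Require Import Relation_Operators.

Set Implicit Arguments.
Unset Strict Implicit.
Unset Printing Implicit Defensive.

Local Open Scope classical_set_scope.

(* All alphabets are subsets of one type Act, so that alphabets of different
   systems can be compared.  Transition labels are of type option Act: None is
   tau, which therefore belongs to no alphabet. *)

Definition labels (Act : Type) (A : set Act) : set (option Act) := Some @` A.

Definition labels_tau (Act : Type) (A : set Act) : set (option Act) :=
  labels A `|` [set None].

Record dMTS (Act : Type) (A : set Act) := DMTS {
  state :> Type;
  must : state -> Act -> set state -> Prop;
  may : state -> option Act -> state -> Prop;
  must_label : forall p a P', must p a P' -> A a;
  must_nonempty : forall p a P', must p a P' -> P' !=set0;
  may_label : forall p l p', may p l p' -> labels_tau A l;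
  must_may : forall p a P', must p a P' -> forall p', P' p' -> may p (Some a) p'
}.

Record MIA (Act : Type) := MkMIA {
  inp : set Act;
  out : set Act;
  inp_out_disjoint : inp `&` out = set0;
  dmts :> dMTS (inp `|` out);
  inp_must_det : forall i, inp i -> forall (p : dmts) P' P'',
    must p i P' -> must p i P'' -> P' = P'';
  inp_may_must : forall i, inp i -> forall p p' : dmts,
    may p (Some i) p' -> exists2 P', must p i P' & P' p'
}.

Definition alph (Act : Type) (P : MIA Act) : set Act := inp P `|` out P.

Section Weak.
Variables (Act : Type) (P : MIA Act).

Definition has_must (p : P) (a : Act) : Prop := exists P', must p a P'.

Definition has_may (p : P) (a : Act) : Prop := exists p', may p (Some a) p'.

Definition weak_eps (p p' : P) : Prop :=
  clos_refl_trans P (fun x y => may x None y) p p'.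

Definition weak_may (p : P) (l : option Act) (p' : P) : Prop :=
  exists p'', weak_eps p p'' /\ may p'' l p'.

Definition weak_may_hat (p : P) (l : option Act) (p' : P) : Prop :=
  if l is Some a then weak_may p (Some a) p' else weak_eps p p'.

End Weak.

Section Refinement.
Variables (Act : Type) (P Q : MIA Act).

Definition MIA_refinement_relation (R : P -> Q -> Prop) : Prop :=
  forall p q, R p q ->
    (forall a Q', alph Q a -> must q a Q' ->
       exists P', must p a P' /\
         forall p', P' p' -> exists q', Q' q' /\ R p' q') /\
    (forall l p', labels_tau (out P) l -> may p l p' ->
       exists q', weak_may_hat q l q' /\ R p' q').

Definition MIA_refines (p : P) (q : Q) : Prop :=
  inp P = inp Q /\ out P = out Q /\
  exists R : P -> Q -> Prop, R p q /\ MIA_refinement_relation R.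

End Refinement.

Definition composable (Act : Type) (P1 P2 : MIA Act) : Prop :=
  alph P1 `&` alph P2 = (inp P1 `&` out P2) `|` (out P1 `&` inp P2).

(* The product and the parallel composition of P1 and P2 are MIAs whether or not
   P1 and P2 are composable, so they are defined for arbitrary P1 and P2. *)

Section Product.
Variables (Act : Type) (P1 P2 : MIA Act).

Definition prod_inp : set Act := (inp P1 `|` inp P2) `\` (out P1 `|` out P2).

Definition prod_out : set Act := (out P1 `|` out P2) `\` (inp P1 `|` inp P2).

Inductive prod_must : P1 * P2 -> Act -> set (P1 * P2) -> Prop :=
| Must1 p1 p2 a P1' :
    must p1 a P1' -> ~ alph P2 a -> prod_must (p1, p2) a (P1' `*` [set p2])
| Must2 p1 p2 a P2' :
    must p2 a P2' -> ~ alph P1 a -> prod_must (p1, p2) a ([set p1] `*` P2').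

Inductive prod_may : P1 * P2 -> option Act -> P1 * P2 -> Prop :=
| May1 p1 p2 l p1' :
    may p1 l p1' -> ~ labels (alph P2) l -> prod_may (p1, p2) l (p1', p2)
| May2 p1 p2 l p2' :
    may p2 l p2' -> ~ labels (alph P1) l -> prod_may (p1, p2) l (p1, p2')
| May3 p1 p2 a p1' p2' :
    may p1 (Some a) p1' -> may p2 (Some a) p2' ->
    prod_may (p1, p2) None (p1', p2').

Lemma prod_alph1 a : alph P1 a -> ~ alph P2 a -> (prod_inp `|` prod_out) a.
Proof.
move=> [h|h] n; [left|right]; split; first by left.
- case=> h'; last by apply: n; right.
  by have := inp_out_disjoint P1; rewrite -subset0 => /(_ a); apply.
- by left.
- case=> h'; last by apply: n; left.
  by have := inp_out_disjoint P1; rewrite -subset0 => /(_ a); apply.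
Qed.

Lemma prod_alph2 a : alph P2 a -> ~ alph P1 a -> (prod_inp `|` prod_out) a.
Proof.
move=> [h|h] n; [left|right]; split; first by right.
- case=> h'; first by apply: n; right.
  by have := inp_out_disjoint P2; rewrite -subset0 => /(_ a); apply.
- by right.
- case=> h'; first by apply: n; left.
  by have := inp_out_disjoint P2; rewrite -subset0 => /(_ a); apply.
Qed.

Lemma prod_must_label x a X' : prod_must x a X' -> (prod_inp `|` prod_out) a.
Proof.
case=> {}x1 x2 {}a {}X' m n; first exact: prod_alph1 (must_label m) n.
exact: prod_alph2 (must_label m) n.
Qed.

Lemma prod_must_nonempty x a X' : prod_must x a X' -> X' !=set0.
Proof.
case=> {}x1 x2 {}a {}X' m n; have [y hy] := must_nonempty m.
- by exists (y, x2).
- by exists (x1, y).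
Qed.

Lemma prod_may_label x l x' :
  prod_may x l x' -> labels_tau (prod_inp `|` prod_out) l.
Proof.
case=> [y1 y2 k z m n|y1 y2 k z m n|*]; last by right.
- case: (may_label m) => [[a ha ka]|]; last by right.
  left; exists a => //; apply: prod_alph1 => // h.
  by apply: n; exists a.
- case: (may_label m) => [[a ha ka]|]; last by right.
  left; exists a => //; apply: prod_alph2 => // h.
  by apply: n; exists a.
Qed.

Lemma prod_must_may x a X' :
  prod_must x a X' -> forall x', X' x' -> prod_may x (Some a) x'.
Proof.
case=> {}x1 x2 {}a {}X' m n [y1 y2] [/= h1 h2].
- by rewrite h2; apply: May1 (must_may m h1) _ => -[b hb [e]]; rewrite -e in n.
- by rewrite h1; apply: May2 (must_may m h2) _ => -[b hb [e]]; rewrite -e in n.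
Qed.

Lemma prod_inp_out_disjoint : prod_inp `&` prod_out = set0.
Proof. by rewrite -subset0 => a [[h _] [_ n]]. Qed.

Definition prod_dMTS : dMTS (prod_inp `|` prod_out) :=
  DMTS prod_must_label prod_must_nonempty prod_may_label prod_must_may.

Lemma prod_inp_must_det i : prod_inp i -> forall (x : prod_dMTS) X' X'',
  must x i X' -> must x i X'' -> X' = X''.
Proof.
move=> [hi no] x X' X'' /= m1.
case: m1 hi no => {}x1 x2 {}i {}X' m n hi no m2; inversion m2; subst.
- congr (_ `*` _); apply: inp_must_det m _ => //.
  by case: hi => // h; case: n; left.
- by case: n; apply: must_label; eassumption.
- by case: n; apply: must_label; eassumption.
- congr (_ `*` _); apply: inp_must_det m _ => //.
  by case: hi => // h; case: n; left.
Qed.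

Lemma prod_inp_may_must i : prod_inp i -> forall x x' : prod_dMTS,
  may x (Some i) x' -> exists2 X', must x i X' & X' x'.
Proof.
move=> [hi no] x x' /= m; inversion m as [? ? ? ? m' n|? ? ? ? m' n|]; subst.
- have n' : ~ alph P2 i by move=> h; apply: n; exists i.
  have [|X' mX hX] := inp_may_must _ m'.
    by case: hi => // h; case: n'; left.
  by eexists; first exact: Must1 mX n'.
- have n' : ~ alph P1 i by move=> h; apply: n; exists i.
  have [|X' mX hX] := inp_may_must _ m'.
    by case: hi => // h; case: n'; left.
  by eexists; first exact: Must2 mX n'.
Qed.

Definition prod_MIA : MIA Act :=
  MkMIA prod_inp_out_disjoint prod_inp_must_det prod_inp_may_must.

Definition error_state (x : prod_MIA) : Prop :=
  exists a, (alph P1 `&` alph P2) a /\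
    ((out P1 a /\ has_may x.1 a /\ ~ has_must x.2 a) \/
     (out P2 a /\ has_may x.2 a /\ ~ has_must x.1 a)).

Inductive incompatible : set prod_MIA :=
| incompatible_error x : error_state x -> incompatible x
| incompatible_step x l x' :
    labels_tau (out prod_MIA) l -> may x l x' -> incompatible x' ->
    incompatible x.

Definition removed_must (x : prod_MIA) (a : Act) (X' : set prod_MIA) : Prop :=
  must x a X' /\ (incompatible x \/ exists x', X' x' /\ incompatible x').

Definition par_state : Type := {x : prod_MIA | ~ incompatible x}.

(* A set S' of remaining states is, as a set of states of the product, the
   image of S' under sval; in particular it contains no removed state. *)
Definition par_must (s : par_state) (a : Act) (S' : set par_state) : Prop :=
  must (sval s) a (sval @` S').

Definition par_may (s : par_state) (l : option Act) (s' : par_state) : Prop :=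
  may (sval s) l (sval s') /\
  ~ (exists a X', l = Some a /\ removed_must (sval s) a X' /\ X' (sval s')).

Lemma par_must_label s a S' :
  par_must s a S' -> (inp prod_MIA `|` out prod_MIA) a.
Proof. exact: must_label. Qed.

Lemma par_must_nonempty s a S' : par_must s a S' -> S' !=set0.
Proof. by move=> m; case: (must_nonempty m) => _ [s' hs' _]; exists s'. Qed.

Lemma par_may_label s l s' :
  par_may s l s' -> labels_tau (inp prod_MIA `|` out prod_MIA) l.
Proof. by move=> [m _]; exact: may_label m. Qed.

Lemma par_must_may s a S' :
  par_must s a S' -> forall s', S' s' -> par_may s (Some a) s'.
Proof.
move=> m s' hs'; split; first by apply: (must_may m); exists s'.
move=> [_ [X' [[<-] [[mX hX] _]]]].
case: hX => [/(svalP s)//|[x' [hx' ix']]].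
case: (must_label m) => [hi|ho].
  have e := inp_must_det hi mX m; rewrite e in hx'.
  by case: hx' => t _ et; apply: (svalP t); rewrite et.
apply: (svalP s); apply: (@incompatible_step _ (Some a) x' _ (must_may mX hx') ix').
by left; exists a.
Qed.

Definition par_dMTS : dMTS (inp prod_MIA `|` out prod_MIA) :=
  DMTS par_must_label par_must_nonempty par_may_label par_must_may.

Lemma par_inp_must_det i : inp prod_MIA i -> forall (s : par_dMTS) S' S'',
  must s i S' -> must s i S'' -> S' = S''.
Proof.
move=> hi s S' S'' m1 m2; have e := inp_must_det hi m1 m2.
have sval_inj (x y : par_state) : sval x = sval y -> x = y.
  by case: x y => [x hx] [y hy] /= exy; apply: eq_exist.
apply/seteqP; split=> t ht.
- have : (sval @` S'') (sval t) by rewrite -e; exists t.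
  by move=> [u hu /sval_inj <-].
- have : (sval @` S') (sval t) by rewrite e; exists t.
  by move=> [u hu /sval_inj <-].
Qed.

Lemma par_inp_may_must i : inp prod_MIA i -> forall s s' : par_dMTS,
  may s (Some i) s' -> exists2 S', must s i S' & S' s'.
Proof.
move=> hi s s' [m nr]; have [X' mX hX] := inp_may_must hi m.
exists (sval @^-1` X') => //; rewrite /= /par_must.
suff -> : sval @` (sval @^-1` X' : set par_state) = X' by [].
apply/seteqP; split=> [_ [t ht <-]//|x' hx'].
have nx : ~ incompatible x'.
  move=> ix; apply: nr; exists i, X'; split=> //; split=> //; split=> //.
  by right; exists x'.
by exists (exist _ x' nx).
Qed.

Definition par_MIA : MIA Act :=
  MkMIA (inp_out_disjoint prod_MIA) par_inp_must_det par_inp_may_must.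

Definition compatible (p1 : P1) (p2 : P2) : Prop := ~ incompatible (p1, p2).

Definition par_pair (p1 : P1) (p2 : P2) (h : compatible p1 p2) : par_MIA :=
  exist _ (p1, p2) h.

End Product.

(* Main.v *)
(* If [R] witnesses [p1 ⊑ q1], then [{(p1|p2, q1|p2) | R p1 q1}] witnesses
   [p1|p2 ⊑ q1|p2].  The only delicate transition is a synchronisation on an
   input [a] of the first component, since refinement does not constrain the
   input-may-transitions of [p1]: either [q1] has no [a]-must-transition, and
   then [(q1, p2)] is an error state, or the must-transition of [q1] is matched
   by the only one of [p1], whose targets include every [a]-may-successor. *)
Require Import Defs.
From mathcomp Require Import all_boot.
From mathcomp Require Import boolp classical_sets.
From Stdlib Require Import Relation_Operators.

Set Implicit Arguments.
Unset Strict Implicit.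
Unset Printing Implicit Defensive.

Local Open Scope classical_set_scope.

Lemma labels_Some (Act : Type) (A : set Act) a : labels A (Some a) <-> A a.
Proof. by split=> [[b hb [<-]]|ha] //; exists a. Qed.

Lemma labels_None (Act : Type) (A : set Act) : ~ labels A None.
Proof. by case. Qed.

Lemma labels_tau_Some (Act : Type) (A : set Act) a :
  labels_tau A (Some a) <-> A a.
Proof. by split=> [[/labels_Some|]|ha] //; left; apply/labels_Some. Qed.

Lemma may_alph (Act : Type) (P : MIA Act) (p p' : P) a :
  may p (Some a) p' -> alph P a.
Proof. by move=> /may_label /labels_tau_Some. Qed.

Lemma prod_weak_eps_l (Act : Type) (P1 P2 : MIA Act) (p1 p1' : P1) (p2 : P2) :
  weak_eps p1 p1' -> @weak_eps _ (prod_MIA P1 P2) (p1, p2) (p1', p2).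
Proof.
elim=> [x y m|x|x y z _ h1 _ h2].
- by apply: rt_step; apply: May1 m _; exact: labels_None.
- exact: rt_refl.
- exact: rt_trans h1 h2.
Qed.

Lemma prod_weak_may_hat_l (Act : Type) (P1 P2 : MIA Act) (p1 p1' : P1)
    (p2 : P2) l :
  weak_may_hat p1 l p1' -> ~ labels (alph P2) l ->
  @weak_may_hat _ (prod_MIA P1 P2) (p1, p2) l (p1', p2).
Proof.
case: l => [a|] /=; last by move=> h _; exact: prod_weak_eps_l.
move=> [p1'' [h m]] n; exists (p1'', p2); split; first exact: prod_weak_eps_l.
exact: May1 m n.
Qed.

Lemma may_weak_may_hat (Act : Type) (P : MIA Act) (p p' : P) l :
  may p l p' -> weak_may_hat p l p'.
Proof.
case: l => [a|] m; last exact: rt_step.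
by exists p; split=> //; exact: rt_refl.
Qed.

Lemma incompatible_weak_eps (Act : Type) (P1 P2 : MIA Act)
    (x x' : prod_MIA P1 P2) :
  weak_eps x x' -> incompatible x' -> incompatible x.
Proof.
elim=> [y z m|//|y z t _ h1 _ h2 /h2 /h1 //].
by apply: incompatible_step m; right.
Qed.

Lemma incompatible_weak_may_hat (Act : Type) (P1 P2 : MIA Act)
    (x x' : prod_MIA P1 P2) l :
  labels_tau (out (prod_MIA P1 P2)) l ->
  weak_may_hat x l x' -> incompatible x' -> incompatible x.
Proof.
case: l => [a|] hl /=; last exact: incompatible_weak_eps.
move=> [y [h m]] i; apply: incompatible_weak_eps h _.
exact: incompatible_step hl m i.
Qed.

(** Pruning also deletes may-transitions underlying a removed must-transition. For an output this
    cannot happen at a remaining state [x]: an incompatible must-target would be reached by an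
    output may-transition, making [x] incompatible as well. For tau there is no must-transition. *)
Lemma par_may_lift (Act : Type) (P1 P2 : MIA Act) (x x' : prod_MIA P1 P2) l
    (hx : ~ incompatible x) (hx' : ~ incompatible x') :
  labels_tau (out (prod_MIA P1 P2)) l -> may x l x' ->
  par_may (exist _ x hx) l (exist _ x' hx').
Proof.
move=> hl m; split=> // -[a [X' [el [[/= mX [/hx//|[y [hy iy]]]] _]]]].
by apply: (hx); apply: incompatible_step (prod_must_may mX hy) iy; rewrite -el.
Qed.

(** The path survives pruning: an incompatible intermediate state would already make its start [x]
    incompatible. *)
Lemma par_weak_eps_lift (Act : Type) (P1 P2 : MIA Act)
    (x x' : prod_MIA P1 P2) (hx : ~ incompatible x) (hx' : ~ incompatible x') :
  weak_eps x x' ->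
  @weak_eps _ (par_MIA P1 P2) (exist _ x hx) (exist _ x' hx').
Proof.
move=> h; elim: h hx hx' => [y z m|y|y z t h1 IH1 h2 IH2] hy hz.
- by apply: rt_step; apply: par_may_lift => //; right.
- by rewrite (Prop_irrelevance hy hz); exact: rt_refl.
- have nz : ~ incompatible z by move=> /(incompatible_weak_eps h1).
  exact: rt_trans (IH1 _ nz) (IH2 nz _).
Qed.

Lemma par_weak_may_hat_lift (Act : Type) (P1 P2 : MIA Act)
    (x x' : prod_MIA P1 P2) l
    (hx : ~ incompatible x) (hx' : ~ incompatible x') :
  labels_tau (out (prod_MIA P1 P2)) l -> weak_may_hat x l x' ->
  @weak_may_hat _ (par_MIA P1 P2) (exist _ x hx) l (exist _ x' hx').
Proof.
case: l => [a|] hl /=; last exact: par_weak_eps_lift.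
move=> [y [h m]].
have hy : ~ incompatible y by move=> /(incompatible_weak_eps h).
exists (exist _ y hy); split; first exact: par_weak_eps_lift.
exact: par_may_lift.
Qed.

Lemma par_must_lift (Act : Type) (P1 P2 : MIA Act) (s : par_MIA P1 P2) a
    (X' : set (prod_MIA P1 P2)) :
  must (sval s) a X' -> (forall x', X' x' -> ~ incompatible x') ->
  par_must s a (sval @^-1` X').
Proof.
move=> m hX; rewrite /par_must.
suff -> : sval @` (sval @^-1` X' : set (par_state P1 P2)) = X' by [].
apply/seteqP; split=> [_ [t ht <-]//|x' hx'].
by exists (exist _ x' (hX _ hx')).
Qed.

(** Used twice: to transfer incompatibility from [(p1, p2)] to [(q1, p2)], and for the may-clause of
    the refinement, where the first alternative is excluded by compatibility. *)
Lemma prod_may_refines (Act : Type) (P1 P2 Q1 : MIA Act) (R : P1 -> Q1 -> Prop)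
    (p1 : P1) (p2 : P2) (q1 : Q1) l (x' : prod_MIA P1 P2) :
  inp P1 = inp Q1 -> out P1 = out Q1 -> composable Q1 P2 ->
  MIA_refinement_relation R -> R p1 q1 ->
  labels_tau (prod_out P1 P2) l -> prod_may (p1, p2) l x' ->
  @incompatible _ Q1 P2 (q1, p2) \/
  exists q1', R x'.1 q1' /\
    @weak_may_hat _ (prod_MIA Q1 P2) (q1, p2) l (q1', x'.2).
Proof.
move=> ei eo hc hR r hl m.
have ea : alph P1 = alph Q1 by rewrite /alph ei eo.
have [hmust hmay] := hR _ _ r.
inversion m as [? ? ? p1' m1 n|? ? ? p2' m2 n|? ? a p1' p2' m1 m2]; subst => /=.
(* An output of the product outside the alphabet of [P2] must come from [out P1], so the may-clause
   of [R] applies. *)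
- right; have hl1 : labels_tau (out P1) l.
    case: l hl m1 n {m} => [a|]; last by right.
    move=> /labels_tau_Some [[h|h] _] _ n; first exact/labels_tau_Some.
    by case: n; apply/labels_Some; right.
  have [q1' [w r']] := hmay _ _ hl1 m1.
  by exists q1'; split=> //; exact: prod_weak_may_hat_l.
- right; exists q1; split=> //; apply: may_weak_may_hat.
  by apply: May2 m2 _; rewrite -ea.
- have a1 := may_alph m1; have a2 := may_alph m2.
  have : (inp P1 `&` out P2 `|` out P1 `&` inp P2) a.
    by rewrite ei eo -hc; split; rewrite -?ea.
  move=> [[ha ho]|[ho ha]].
  + have [[Q' mQ]|nm] := pselect (has_must q1 a).
      have aQ : alph Q1 a by rewrite -ea.
      have [P' [mP hP]] := hmust _ _ aQ mQ.
      have [P'' mP'' hp1'] := inp_may_must ha m1.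
      rewrite -(inp_must_det ha mP mP'') in hp1'.
      have [q1' [hq1' r']] := hP _ hp1'.
      right; exists q1'; split=> //; apply: rt_step.
      exact: May3 (must_may mQ hq1') m2.
    left; apply: incompatible_error; exists a; split; first by split; rewrite -?ea.
    by right; split=> //; split=> //; exists p2'.
  (* Here [a] is an output of [P1]. The answer of [q1] may start with tau steps; they interleave
     with an idle [p2], and the final synchronisation is again a tau. *)
  + have [q1' [[q1'' [w mq]] r']] := hmay _ _ (proj2 (labels_tau_Some _ _) ho) m1.
    right; exists q1'; split=> //; apply: rt_trans (prod_weak_eps_l p2 w) _.
    by apply: rt_step; exact: May3 mq m2.
Qed.

(** Induction on incompatibility, with [q1] general because each matched step moves it. An error
    state need not be matched by an error state: [q1] may need tau steps before it offers the
    output, so [(q1, p2)] only leads to one. *)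
Lemma incompatible_refines (Act : Type) (P1 P2 Q1 : MIA Act)
    (R : P1 -> Q1 -> Prop) (x : prod_MIA P1 P2) (q1 : Q1) :
  inp P1 = inp Q1 -> out P1 = out Q1 -> composable Q1 P2 ->
  MIA_refinement_relation R -> incompatible x -> R x.1 q1 ->
  @incompatible _ Q1 P2 (q1, x.2).
Proof.
move=> ei eo hc hR ix.
have ea : alph P1 = alph Q1 by rewrite /alph ei eo.
have eO : prod_out P1 P2 = prod_out Q1 P2 by rewrite /prod_out ei eo.
elim: ix q1 => [[p1 p2] [a [[a1 a2] /= H]]|[p1 p2] l x' hl m _ IH] q1 r.
  have [hmust hmay] := hR _ _ r.
  case: H => [[ho [[p1' m] nm]]|[ho [m nm]]].
    have [q1' [[q1'' [w mq]] r']] := hmay _ _ (proj2 (labels_tau_Some _ _) ho) m.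
    apply: incompatible_weak_eps (prod_weak_eps_l p2 w) _.
    apply: incompatible_error; exists a; split; first by split; rewrite -?ea.
    by left; split; rewrite -?eo //; split=> //; exists q1'.
  apply: incompatible_error; exists a; split; first by split; rewrite -?ea.
  right; split=> //; split=> // -[Q' mQ]; apply: nm.
  by have [|P' [mP _]] := hmust _ _ _ mQ; [rewrite -ea|exists P'].
have [//|[q1' [r' w]]] := prod_may_refines ei eo hc hR r hl m.
apply: incompatible_weak_may_hat w (IH _ r').
by rewrite /= -eO.
Qed.

Theorem theorem4p14 (Act : Type) (P1 P2 Q1 : MIA Act)
    (p1 : P1) (p2 : P2) (q1 : Q1)
    (href : MIA_refines p1 q1) (hcomp : composable Q1 P2) :
  composable P1 P2 /\
  (forall hq : compatible q1 p2,
     exists hp : compatible p1 p2,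
       MIA_refines (par_pair hp) (par_pair hq)).
Proof.
case: href => ei [eo [R [r hR]]].
have ea : alph P1 = alph Q1 by rewrite /alph ei eo.
have eI : prod_inp P1 P2 = prod_inp Q1 P2 by rewrite /prod_inp ei eo.
have eO : prod_out P1 P2 = prod_out Q1 P2 by rewrite /prod_out ei eo.
split; first by rewrite /composable ea ei eo.
have hinc (u1 : P1) (v1 : Q1) (u2 : P2) :
    R u1 v1 -> compatible v1 u2 -> compatible u1 u2.
  move=> h c i; apply: c.
  exact: (@incompatible_refines _ _ _ _ _ (u1, u2) _ ei eo hcomp hR i h).
move=> hq; exists (hinc _ _ _ r hq); split=> //; split=> //.
exists (fun s t => R (sval s).1 (sval t).1 /\ (sval s).2 = (sval t).2).
split=> //.
move=> [[u1 u2] hu] [[v1 v2] hv] /= [ruv euv]; rewrite -{}euv in hv *.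
have [hmust hmay] := hR _ _ ruv.
split.
- move=> a S' _ mS; rewrite /par_must /= in mS.
  (* Inversion gives the target set only as a product equal to the image of [S']; this turns each of
     its pairs into a state in [S'], hence a compatible one. *)
  have hS X y : X = sval @` S' -> X y -> exists t, S' t /\ sval t = y.
    by move=> -> [t ht et]; exists t.
  inversion mS as [? ? ? V' mV n|? ? ? V' mV n]; subst.
  + have aQ : alph Q1 a := must_label mV.
    have [U' [mU hU]] := hmust _ _ aQ mV.
    exists (sval @^-1` (U' `*` [set u2])); split.
      apply: par_must_lift; first exact: Must1 mU n.
      move=> [w1 w2] [/= hw ->]; have [z1 [hz rz]] := hU _ hw.
      (* The matching pair [(z1, u2)] is a must-target that survived pruning, so [hinc] makes
         [(w1, u2)] compatible too. *)
      have [t [_ et]] : exists t, S' t /\ sval t = (z1, u2) by apply: hS; first eassumption.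
      by apply: hinc rz _; rewrite /compatible -et; exact: (svalP t).
    move=> [[w1 w2] hw'] [/= hw ew]; have [z1 [hz rz]] := hU _ hw.
    have [t [St et]] : exists t, S' t /\ sval t = (z1, u2) by apply: hS; first eassumption.
    by exists t; rewrite et.
  + exists (sval @^-1` ([set u1] `*` V')); split.
      apply: par_must_lift; first by apply: Must2 mV _; rewrite ea.
      move=> [w1 w2] [/= -> hw].
      have [t [_ et]] : exists t, S' t /\ sval t = (v1, w2) by apply: hS; first eassumption.
      by apply: hinc ruv _; rewrite /compatible -et; exact: (svalP t).
    move=> [[w1 w2] hw'] [/= -> hw].
    have [t [St et]] : exists t, S' t /\ sval t = (v1, w2) by apply: hS; first eassumption.
    by exists t; rewrite et.
- move=> l [x' hx'] hl [m _].
  have [//|[z1 [rz w]]] := prod_may_refines ei eo hcomp hR ruv hl m.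
  have hlQ : labels_tau (out (prod_MIA Q1 P2)) l by rewrite /= -eO.
  (* Incompatibility propagates backwards along output and tau moves, so it would reach [(v1, u2)],
     which is compatible by [hv]. *)
  have hz : ~ @incompatible _ Q1 P2 (z1, x'.2).
    by move=> /(incompatible_weak_may_hat hlQ w).
  exists (par_pair hz); split=> //.
  exact: par_weak_may_hat_lift.
Qed.
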